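(* Let $(X,p)$ be a complete partial $b$-metric space with coefficient $s\geq2$, $X$ nonempty, and let $T:X\to X$ be a mapping for which there is $\lambda\in\left[0,\frac{1}{s^2}\right)$ such that $$p(Tx,Ty)\leq\lambda\,[p(x,Ty)+p(y,Tx)]\quad\text{for all }x,y\in X.$$ Then $T$ has a unique fixed point $u\in X$, and $p(u,u)=0$.
   Context: A partial $b$-metric space with coefficient $s\geq1$ is a pair $(X,p)$ where $X$ is a set and $p:X\times X\to[0,\infty)$ satisfies: (pm1) for all $x,y\in X$, $x=y$ if and only if $p(x,x)=p(x,y)=p(y,y)$; (pm2) $0\leq p(x,x)\leq p(x,y)$ for all $x,y\in X$; (pm3) $p(x,y)=p(y,x)$ for all $x,y\in X$; (pm4) $p(x,y)+p(z,z)\leq s[p(x,z)+p(z,y)]$ for all $x,y,z\in X$. A sequence $(x_n)_{n\ge1}$ in $X$ is $p$-Cauchy if $\lim_{n,m\to\infty}p(x_n,x_m)$ exists and is finite. $(X,p)$ is complete if for every $p$-Cauchy sequence $(x_n)_{n\ge1}$ in $X$ there exists $x\in X$ such that $\lim_{n,m\to\infty}p(x_n,x_m)=\lim_{n\to\infty}p(x,x_n)=p(x,x)$. *)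

(* Defs.v *)
From mathcomp Require Import all_boot all_order all_algebra.
From mathcomp Require Import all_classical all_reals all_analysis.

Set Implicit Arguments.
Unset Strict Implicit.
Unset Printing Implicit Defensive.

Import Order.TTheory GRing.Theory Num.Theory.
Import numFieldNormedType.Exports.

Local Open Scope classical_set_scope.
Local Open Scope ring_scope.

Record partial_b_metric (R : realType) (X : Type) (s : R) (p : X -> X -> R) :
    Prop := PartialBMetric {
  pbm_coef_ge1 : 1 <= s;
  pbm_ge0 : forall x y, 0 <= p x y;
  pbm_eq : forall x y, x = y <-> p x x = p x y /\ p x y = p y y;
  pbm_self : forall x y, 0 <= p x x <= p x y;
  pbm_sym : forall x y, p x y = p y x;
  pbm_triangle : forall x y z, p x y + p z z <= s * (p x z + p z y)
}.

(* The double limit is a limit along the product filter (n and m go to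
   infinity independently). Sequences are indexed from 0. *)
Definition p_double_lim (R : realType) (X : Type) (p : X -> X -> R)
    (x : nat -> X) (l : R) : Prop :=
  p (x nm.1) (x nm.2) @[nm --> (\oo, \oo)] --> l.

Definition p_cauchy (R : realType) (X : Type) (p : X -> X -> R)
    (x : nat -> X) : Prop :=
  exists l : R, p_double_lim p x l.

Definition p_complete (R : realType) (X : Type) (p : X -> X -> R) : Prop :=
  forall x : nat -> X, p_cauchy p x ->
    exists a : X, p_double_lim p x (p a a) /\
      p a (x n) @[n --> \oo] --> p a a.

(* Main.v *)
Require Import Defs.
From mathcomp Require Import all_boot all_order all_algebra.
From mathcomp Require Import all_classical all_reals all_analysis.
From mathcomp Require Import lra.

(** For the orbit x n = T^n x0, the contraction and the triangle inequality
    through x (n+1) give d (n+1) <= lambda s (d n + d (n+1)), where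
    d n = p (x n) (x (n+1)); since 2 lambda s < 1, d decays geometrically.
    The same argument absorbs p (x (n+1)) (x (m+1)) into itself and bounds it
    by a multiple of d n + d m, so the orbit is Cauchy with double limit 0.
    Its limit u satisfies (1 - lambda s^2) p u (T u) <= o(1), whence T u = u. *)

Set Implicit Arguments.
Unset Strict Implicit.

Import Order.TTheory GRing.Theory Num.Theory.
Import numFieldNormedType.Exports.

Local Open Scope ring_scope.

Definition chatterjea (R : realType) (X : Type) (p : X -> X -> R)
    (lambda : R) (T : X -> X) : Prop :=
  forall x y, p (T x) (T y) <= lambda * (p x (T y) + p y (T x)).

Lemma pbm_triangle_le (R : realType) (X : Type) (s : R) (p : X -> X -> R) :
  partial_b_metric s p -> forall x y z, p x y <= s * (p x z + p z y).
Proof.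
move=> hp x y z.
have := pbm_triangle hp x y z; have := pbm_ge0 hp z z; lra.
Qed.

(** By (pm2) both self-distances lie between 0 and [p x y]. *)
Lemma pbm_eq0 (R : realType) (X : Type) (s : R) (p : X -> X -> R) x y :
  partial_b_metric s p -> p x y = 0 -> x = y.
Proof.
move=> hp xy0; apply/(pbm_eq hp).
have /andP[x0 xxy] := pbm_self hp x y.
have /andP[y0] := pbm_self hp y x; rewrite (pbm_sym hp y x) => yxy.
by split; lra.
Qed.

(** Since [2 <= s], 2 lambda <= lambda s and 2 lambda s <= lambda s^2 < 1. The three bounds serve,
    in order, uniqueness, convergence of the orbit, and fixedness of its limit. *)
Lemma chatterjea_coef (R : realType) (s lambda : R) :
  2 <= s -> 0 <= lambda < 1 / s ^+ 2 ->
  [/\ 2 * lambda < 1, 2 * (lambda * s) < 1 & s * (lambda * s) < 1].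
Proof.
move=> hs /andP[l0]; rewrite ltr_pdivlMr; last by rewrite exprn_gt0//; lra.
rewrite expr2 => ls.
have ls0 : 0 <= lambda * s by apply: mulr_ge0 => //; lra.
have : 0 <= (s - 2) * (lambda * s) by apply: mulr_ge0 => //; lra.
have : 0 <= (s - 2) * lambda by apply: mulr_ge0 => //; lra.
by split; lra.
Qed.

Lemma chatterjea_orbit_step (R : realType) (X : Type) (s lambda : R)
    (p : X -> X -> R) (T : X -> X) :
  partial_b_metric s p -> chatterjea p lambda T -> 0 <= lambda ->
  2 * (lambda * s) < 1 -> forall x,
  p (T x) (T (T x)) <= lambda * s / (1 - lambda * s) * p x (T x).
Proof.
move=> hp hT l0 ls x.
have ls0 : 0 <= lambda * s.
  by apply: mulr_ge0 => //; apply: le_trans (pbm_coef_ge1 hp).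
rewrite mulrAC ler_pdivlMr; last by lra.
have := hT x (T x).
(* The self-distance in the contraction is cancelled by the one in pbm_triangle *)
have := ler_wpM2l l0 (pbm_triangle hp x (T (T x)) (T x)).
lra.
Qed.

Lemma chatterjea_orbit_geometric (R : realType) (X : Type) (s lambda : R)
    (p : X -> X -> R) (T : X -> X) :
  partial_b_metric s p -> chatterjea p lambda T -> 0 <= lambda ->
  2 * (lambda * s) < 1 -> forall x n,
  p (iter n T x) (iter n.+1 T x) <=
    (lambda * s / (1 - lambda * s)) ^+ n * p x (T x).
Proof.
move=> hp hT l0 ls x; elim=> [|n IHn]; first by rewrite expr0 mul1r.
have ls0 : 0 <= lambda * s.
  by apply: mulr_ge0 => //; apply: le_trans (pbm_coef_ge1 hp).
apply: le_trans (chatterjea_orbit_step hp hT l0 ls (iter n T x)) _.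
by rewrite exprS -[leRHS]mulrA ler_wpM2l// divr_ge0//; lra.
Qed.

(** Passing from [x] to [T y] through [T x], and from [y] to [T x] through [T y], yields two copies
    of [p (T x) (T y)], each with factor lambda s; moving them to the left leaves 1 - 2 lambda s. *)
Lemma chatterjea_image_le (R : realType) (X : Type) (s lambda : R)
    (p : X -> X -> R) (T : X -> X) :
  partial_b_metric s p -> chatterjea p lambda T -> 0 <= lambda ->
  2 * (lambda * s) < 1 -> forall x y,
  p (T x) (T y) <=
    lambda * s / (1 - 2 * (lambda * s)) * (p x (T x) + p y (T y)).
Proof.
move=> hp hT l0 ls x y.
rewrite mulrAC ler_pdivlMr; last by lra.
have := hT x y.
have := ler_wpM2l l0 (pbm_triangle_le hp x (T y) (T x)).
have := ler_wpM2l l0 (pbm_triangle_le hp y (T x) (T y)).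
rewrite (pbm_sym hp (T y) (T x)); lra.
Qed.

(** The orbit starts at [T x] because [chatterjea_image_le] bounds distances between images only. *)
Lemma chatterjea_orbit_double_lim (R : realType) (X : Type) (s lambda : R)
    (p : X -> X -> R) (T : X -> X) :
  partial_b_metric s p -> chatterjea p lambda T -> 0 <= lambda ->
  2 * (lambda * s) < 1 -> forall x,
  p_double_lim p (fun n => iter n.+1 T x) 0.
Proof.
move=> hp hT l0 ls x.
have ls0 : 0 <= lambda * s.
  by apply: mulr_ge0 => //; apply: le_trans (pbm_coef_ge1 hp).
set k := lambda * s / (1 - lambda * s).
have k0 : 0 <= k by rewrite divr_ge0//; lra.
(* After clearing the denominator this is exactly 2 lambda s < 1. *)
have k1 : k < 1 by rewrite ltr_pdivrMr; lra.
set c := lambda * s / (1 - 2 * (lambda * s)).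
have c0 : 0 <= c by rewrite divr_ge0//; lra.
pose g n : R := k ^+ n * p x (T x).
have g0 : (g n @[n --> \oo] --> (0 : R))%classic.
  rewrite -[0](mul0r (p x (T x))).
  by apply: cvgMl; apply: cvg_expr; rewrite ger0_norm.
(* Each summand depends on one index, so its limit along the product filter comes from a
   projection. *)
have gg0 : (c * (g nm.1 + g nm.2) @[nm --> (\oo, \oo)] --> (0 : R))%classic.
  rewrite -[0](mulr0 c) -[X in c * X](addr0 0).
  apply: cvgMr; apply: cvgD.
    exact: cvg_comp cvg_fst g0.
  exact: cvg_comp cvg_snd g0.
apply: (squeeze_cvgr _ (cvg_cst 0) gg0).
apply: nearW => -[n m] /=; rewrite (pbm_ge0 hp)/=.
apply: le_trans (chatterjea_image_le hp hT l0 ls _ _) _.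
by rewrite ler_wpM2l// lerD// chatterjea_orbit_geometric.
Qed.

(** At fixed points the contraction reads [p u v <= 2 * lambda * p u v]. *)
Lemma chatterjea_fixed_dist0 (R : realType) (X : Type) (s lambda : R)
    (p : X -> X -> R) (T : X -> X) :
  partial_b_metric s p -> chatterjea p lambda T -> 2 * lambda < 1 ->
  forall u v, T u = u -> T v = v -> p u v = 0.
Proof.
move=> hp hT l1 u v Tu Tv; apply/eqP; rewrite eq_le (pbm_ge0 hp) andbT.
have := hT u v; rewrite Tu Tv (pbm_sym hp v u) => huv.
have : (1 - 2 * lambda) * p u v <= 0 by lra.
by rewrite pmulr_rle0//; lra.
Qed.

Lemma chatterjea_lim_fixed (R : realType) (X : Type) (s lambda : R)
    (p : X -> X -> R) (T : X -> X) :
  partial_b_metric s p -> chatterjea p lambda T -> 0 <= lambda ->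
  s * (lambda * s) < 1 -> forall u (x : nat -> X),
  (forall n, x n.+1 = T (x n)) -> (p u (x n) @[n --> \oo] --> (0 : R))%classic ->
  T u = u.
Proof.
move=> hp hT l0 ls u x xS xu.
have s0 : 0 <= s by apply: le_trans (pbm_coef_ge1 hp).
suff uTu : p u (T u) <= 0.
  by apply/esym/(pbm_eq0 hp)/eqP; rewrite eq_le uTu (pbm_ge0 hp).
suff : (1 - s * (lambda * s)) * p u (T u) <= 0.
  by rewrite pmulr_rle0//; lra.
have xu1 : (p u (x n.+1) @[n --> \oo] --> (0 : R))%classic.
  by rewrite (cvg_shiftS (fun n => p u (x n))).
(* Go from [u] to [T u] through [x n.+1], contract, then go from [x n] to [T u] through [u]. The
   resulting term lambda s^2 [p u (T u)] moves to the left; this sum remains. *)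
have bound0 : (s * (1 + lambda) * p u (x n.+1) + s * (lambda * s) * p u (x n)
    @[n --> \oo] --> (0 : R))%classic.
  rewrite [X in (_ --> X)%classic](_ : _ =
    s * (1 + lambda) * 0 + s * (lambda * s) * 0); last by rewrite !mulr0 addr0.
  by apply: cvgD; apply: cvgMr.
apply: (ler_cvg_to (cvg_cst _) bound0); apply: nearW => n.
rewrite xS.
have := pbm_triangle_le hp u (T u) (T (x n)).
have := ler_wpM2l s0 (hT (x n) u).
have := ler_wpM2l (mulr_ge0 s0 l0) (pbm_triangle_le hp (x n) (T u) u).
rewrite (pbm_sym hp (x n) u); lra.
Qed.

Theorem theorem3p1 (R : realType) (X : Type) (s : R) (p : X -> X -> R)
    (hX : inhabited X) (hp : partial_b_metric s p) (hcomplete : p_complete p)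
    (hs : 2 <= s) (T : X -> X)
    (hT : exists lambda : R, 0 <= lambda < 1 / s ^+ 2 /\
       forall x y : X, p (T x) (T y) <= lambda * (p x (T y) + p y (T x))) :
  exists u : X, unique (fun v => T v = v) u /\ p u u = 0.
Proof.
case: hX hT => x0 [lambda [hl hT]].
have [l1 ls1 lss1] := chatterjea_coef hs hl.
have /andP[l0 _] := hl.
have x0lim := chatterjea_orbit_double_lim hp hT l0 ls1 x0.
have [u [ulim xu]] := hcomplete _ (ex_intro _ _ x0lim).
(* Completeness makes [p u u] the double limit of the orbit, which is already known to be 0. *)
have uu0 : p u u = 0 by exact: cvg_unique ulim x0lim.
have Tu : T u = u.
  apply: (chatterjea_lim_fixed hp hT l0 lss1 (u := u)
    (x := fun n => iter n.+1 T x0)) => //.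
  by rewrite uu0 in xu.
exists u; split=> //; split=> // v Tv.
apply: (pbm_eq0 hp).
exact: (chatterjea_fixed_dist0 hp hT l1).
Qed.
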